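(* Let $\mathbb{K}$ be a field and let $a$, $p$ and $m$ be positive integers with $a\ge2$ and $1\le m\le p$. The partition complex $\mathcal{P}(a,p,m)$ is PR (over $\mathbb{K}$) with degree type $(\overbrace{1,\dots,1,\underbrace{a,1,\dots,1}_{m}}^{p})$; that is, the degree type $(d_p,\dots,d_1)$ with $d_m=a$ and $d_i=1$ for $i\ne m$.
   Context: Partition complexes: for $a\ge2$ and $1\le m\le p$, let $V_p^a$ be the vertex set consisting of vertices $x_i$ and $y_i^j$ for $0\le i\le p$, $1\le j\le a-1$. The symmetric group on $\{0,\dots,p\}$ acts on $V_p^a$ by $g(x_i)=x_{g(i)}$, $g(y_i^j)=y_{g(i)}^j$. For $1\le i\le m$ let $\mathbb{P}(a,i)$ be the set of partitions $\lambda=(\lambda_1\ge\dots\ge\lambda_i>0)$ of $a+i-2$ into exactly $i$ parts, and for $\lambda\in\mathbb{P}(a,i)$ set $$G_{p,i}^\lambda=\{x_i,\dots,x_p\}\sqcup\{y_r^j:0\le r\le i-1,\ 1\le j\le\lambda_{r+1}\}.$$ $\mathcal{P}(a,p,m)$ is the simplicial complex on $V_p^a$ whose faces are all subsets of the sets $g\,G_{p,i}^\lambda$ with $1\le i\le m$, $\lambda\in\mathbb{P}(a,i)$ and $g$ a permutation of $\{0,\dots,p\}$. PR complexes: $\widetilde{H}_i$ is reduced simplicial homology with coefficients in $\mathbb{K}$ (with $\widetilde H_{-1}(\{\emptyset\})=\mathbb{K}$), and $\mathrm{link}_\Delta\sigma=\{\tau\in\Delta:\sigma\cap\tau=\emptyset,\sigma\cup\tau\in\Delta\}$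 for a face $\sigma$. A simplicial complex $\Delta$ is PR (over $\mathbb{K}$) if for every $i\ge-1$ and all faces $\sigma,\tau\in\Delta$ with $\widetilde H_i(\mathrm{link}_\Delta\sigma)\ne0\ne\widetilde H_i(\mathrm{link}_\Delta\tau)$ we have $|\sigma|=|\tau|$. For a PR complex $\Delta$, let $q$ be the maximum index for which some face $\sigma$ has $\widetilde H_{q-1}(\mathrm{link}_\Delta\sigma)\neq0$. For each $0\le i\le q$ faces $\sigma$ with $\widetilde H_{i-1}(\mathrm{link}_\Delta\sigma)\ne0$ exist; let $s_i$ be their common size. The degree type of $\Delta$ is $(d_q,\dots,d_1)$ with $d_i=s_{i-1}-s_i$ (these are positive integers). *)

(* Defs.v *)
From HB Require Import structures.
From mathcomp Require Import all_boot all_order all_fingroup all_algebra.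

Set Implicit Arguments.
Unset Strict Implicit.
Unset Printing Implicit Defensive.

Import Order.TTheory GRing.Theory Num.Theory.
Local Open Scope ring_scope.

Record complex (V : finType) := Complex {
  faces :> {set {set V}};
  faces_closed : forall F G : {set V}, G \subset F -> F \in faces -> G \in faces
}.

Section Link.
Variables (V : finType) (D : complex V) (S : {set V}).

Definition link_faces : {set {set V}} :=
  [set T in D | (S :&: T == set0) && (S :|: T \in D)].

Lemma link_closed (F G : {set V}) :
  G \subset F -> F \in link_faces -> G \in link_faces.
Proof.
move=> sGF; rewrite !inE => /and3P[DF /eqP SF0 DSF].
rewrite (faces_closed sGF DF) (faces_closed _ DSF) ?setUS // andbT /=.
by rewrite -subset0 -SF0 setIS.
Qed.

Definition link : complex V := Complex link_closed.

End Link.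

Section Homology.
Variables (K : fieldType) (V : finType).

(* All the chain groups live inside the space of K-valued functions on the
   subsets of V; the orientation of faces comes from the order of [enum V]. *)
Definition chain := {ffun {set V} -> K^o}.

Definition face_chain (F : {set V}) : chain := [ffun G => (G == F)%:R].

(* The sign (-1)^j, where v is the j-th vertex of F, counting from 0. *)
Definition face_sign (v : V) (F : {set V}) : K :=
  (-1) ^+ #|[set w in F | (enum_rank w < enum_rank v)%N]|.

Definition face_boundary (F : {set V}) : chain :=
  \sum_(v in F) face_sign v F *: face_chain (F :\ v).

Definition boundary_fun (c : chain) : chain :=
  \sum_F (c F : K) *: face_boundary F.

Lemma boundary_fun_is_linear : linear boundary_fun.
Proof.
move=> k c1 c2; rewrite /boundary_fun scaler_sumr -big_split /=.
by apply: eq_bigr => F _; rewrite !ffunE scalerDl scalerA.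
Qed.

HB.instance Definition _ :=
  GRing.isLinear.Build K chain chain *:%R boundary_fun boundary_fun_is_linear.

Definition boundary : 'End(chain) := linfun boundary_fun.

Lemma boundary_face (F : {set V}) : boundary (face_chain F) = face_boundary F.
Proof.
rewrite lfunE /= /boundary_fun (bigD1 F) //= big1 => [|G /negPf nGF].
  by rewrite addr0 ffunE eqxx scale1r.
by rewrite ffunE nGF scale0r.
Qed.

Lemma face_sign_lt (v w : V) (F : {set V}) :
  v \in F -> (enum_rank v < enum_rank w)%N ->
  face_sign v F * face_sign w (F :\ v)
  = - (face_sign w F * face_sign v (F :\ w)).
Proof.
move=> Fv lt_vw; have -> : face_sign v (F :\ w) = face_sign v F.
  rewrite /face_sign; congr (_ ^+ #|pred_of_set _|); apply/setP=> x.
  rewrite !inE; case: eqP => [->|//].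
  by rewrite ltnNge (ltnW lt_vw) /= !andbF.
suff -> : face_sign w F = - face_sign w (F :\ v) by rewrite mulNr opprK mulrC.
rewrite /face_sign (cardsD1 v [set x in F | _]) inE Fv lt_vw exprS mulN1r.
congr (- (_ ^+ #|pred_of_set _|)); apply/setP=> x.
by rewrite !inE; case: eqP; rewrite ?andbF.
Qed.

Lemma boundaryK (c : chain) : boundary (boundary c) = 0.
Proof.
rewrite [boundary c]lfunE /= linear_sum big1 // => F _.
rewrite linearZ /= linear_sum /=.
pose T v w : chain :=
  (face_sign v F * face_sign w (F :\ v)) *: face_chain (F :\ v :\ w).
have TC v w : v \in F -> (enum_rank v < enum_rank w)%N -> T v w = - T w v.
  move=> Fv lt_vw; rewrite /T face_sign_lt // scaleNr; congr (- (_ *: face_chain _)).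
  by rewrite !setDDl setUC.
rewrite (_ : \sum_(v in F) _ = 0) ?scaler0 //.
transitivity (\sum_(v in F) (\sum_(w in F | (enum_rank v < enum_rank w)%N) T v w
   + \sum_(w in F | (enum_rank w < enum_rank v)%N) T v w)).
  apply: eq_bigr => v Fv.
  rewrite linearZ /= boundary_face scaler_sumr.
  rewrite (bigID (fun w => enum_rank v < enum_rank w)%N) /=; congr (_ + _).
    apply: eq_big => [w|w _]; last by rewrite scalerA.
    by rewrite !inE; case: eqP => [->|//]; rewrite ltnn !andbF.
  apply: eq_big => [w|w _]; last by rewrite scalerA.
  rewrite !inE -leqNgt ltn_neqAle (inj_eq val_inj) (inj_eq enum_rank_inj).
  by rewrite andbAC andbC.
rewrite big_split /= [X in _ + X](exchange_big_dep [in F]) /=; last first.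
  by move=> v w _ /andP[].
rewrite -big_split big1 //= => v Fv.
under [X in _ + X]eq_bigl => w do rewrite Fv /=.
rewrite -big_split /= big1 // => w /andP[Fw lt_vw].
by rewrite TC // addNr.
Qed.

Definition face_dim (F : {set V}) : int := #|F|%:Z - 1.

Definition chains (D : complex V) (i : int) : {vspace chain} :=
  <<[seq face_chain F | F : {set V} in [set F in D | face_dim F == i]]>>%VS.

Definition cycles (D : complex V) (i : int) : {vspace chain} :=
  (chains D i :&: lker boundary)%VS.

Definition boundaries (D : complex V) (i : int) : {vspace chain} :=
  (boundary @: chains D (i + 1))%VS.

Lemma boundaries_cycles (D : complex V) (i : int) :
  (boundaries D i <= cycles D i)%VS.
Proof.
rewrite subv_cap; apply/andP; split; last first.
  by apply/subvP=> _ /memv_imgP[c _ ->]; rewrite memv_ker boundaryK.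
rewrite /boundaries limg_span; apply/span_subvP=> c /mapP[c0 /imageP[F]].
rewrite inE => /andP[DF /eqP dimF] -> ->; rewrite boundary_face.
apply: memv_suml => v Fv; apply/memvZ/memv_span/image_f; rewrite inE.
rewrite (faces_closed _ DF) ?subsetDl //= -(inj_eq (addIr 1)) -dimF /face_dim.
by rewrite (cardsD1 v F) Fv /= addrNK PoszD addrAC subrr add0r.
Qed.

(* The i-th reduced homology space: the quotient of the cycles by the
   boundaries, realised as a complement of the boundaries in the cycles. The
   empty face has dimension -1, so that the complex is augmented. *)
Definition homology (D : complex V) (i : int) : {vspace chain} :=
  (cycles D i :\: boundaries D i)%VS.

Definition PR (D : complex V) : Prop :=
  forall (i : int) (S T : {set V}), -1 <= i -> S \in D -> T \in D ->
    homology (link D S) i != 0%VS -> homology (link D T) i != 0%VS ->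
    #|S| = #|T|.

(* Meant for PR complexes; d lists d_q, ..., d_1 in this order, where
   d_i = s_(i-1) - s_i. *)
Definition degree_type (D : complex V) (d : seq int) : Prop :=
  exists (q : nat) (s : nat -> nat),
    [/\ exists2 S, S \in D & homology (link D S) (q%:Z - 1) != 0%VS,
        forall (i : nat) (S : {set V}), S \in D ->
          homology (link D S) (i%:Z - 1) != 0%VS -> (i <= q)%N,
        forall i : nat, (i <= q)%N ->
          (exists2 S, S \in D & homology (link D S) (i%:Z - 1) != 0%VS) /\
          (forall S, S \in D ->
             homology (link D S) (i%:Z - 1) != 0%VS -> #|S| = s i)
      & d = [seq (s i.-1)%:Z - (s i)%:Z | i <- rev (iota 1 q)]].

End Homology.

Section PartitionComplex.
Variables (a p : nat).

(* [inl i] is x_i and [inr (i, j)] is y_i^(j+1). *)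
Definition pvertex : finType := ('I_p.+1 + 'I_p.+1 * 'I_a.-1)%type.

Definition pact (g : 'S_p.+1) (v : pvertex) : pvertex :=
  match v with
  | inl i => inl (g i)
  | inr (i, j) => inr (g i, j)
  end.

Definition is_partition (n k : nat) (lam : seq nat) : bool :=
  [&& sorted geq lam, all (ltn 0) lam, size lam == k & sumn lam == n].

(* [nth 0 lam r] is lambda_(r+1). *)
Definition pfacet (i : nat) (lam : seq nat) : {set pvertex} :=
  [set v : pvertex | match v with
           | inl k => (i <= k)%N
           | inr (r, j) => (r <= i - 1)%N && (j.+1 <= nth 0%N lam r)%N
           end].

(* The parts are bounded only to quantify over a finite type: see
   [partition_facesP]. *)
Definition partition_faces (m : nat) : {set {set pvertex}} :=
  [set F : {set pvertex} |
    [exists i : 'I_m.+1, (0 < i)%N &&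
    [exists lam : i.-tuple 'I_(a + i),
      is_partition (a + i - 2) i (map val lam) &&
    [exists g : 'S_p.+1, F \subset pact g @: pfacet i (map val lam)]]]].

Lemma partition_facesP (m : nat) (F : {set pvertex}) :
  reflect (exists (i : nat) (lam : seq nat) (g : 'S_p.+1),
             [/\ (1 <= i <= m)%N, is_partition (a + i - 2) i lam
               & F \subset pact g @: pfacet i lam])
          (F \in partition_faces m).
Proof.
rewrite inE; apply: (iffP existsP) => [[i /andP[i_gt0]]|].
  case/existsP=> lam /andP[lamP /existsP[g sF]].
  by exists i, (map val lam), g; split; rewrite // i_gt0 -ltnS /=.
case=> i [lam [g [/andP[i_gt0 le_im] lamP sF]]].
have lt_im : (i < m.+1)%N by [].
exists (Ordinal lt_im); rewrite i_gt0 /=.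
have /and4P[_ _ /eqP szlam /eqP sumlam] := lamP.
have ltlam : all (fun k => k < a + i)%N lam.
  apply/allP=> k lamk; apply: (@leq_ltn_trans (a + i - 2)).
    by rewrite -sumlam (perm_sumn (perm_to_rem lamk)) /= leq_addr.
  by rewrite ltn_subrL /= addn_gt0 i_gt0 orbT.
pose s : seq 'I_(a + i) := pmap insub lam.
have valK : map val s = lam.
  rewrite /s; elim: (lam) ltlam => //= k l IHl /andP[ltk /IHl el].
  by rewrite insubT /= el.
have szs : size s == i by rewrite -[i in _ == i]szlam -valK size_map.
apply/existsP; exists (Tuple szs); rewrite [tval _]/= valK lamP /=.
by apply/existsP; exists g.
Qed.

Lemma partition_closed (m : nat) (F G : {set pvertex}) :
  G \subset F -> F \in partition_faces m -> G \in partition_faces m.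
Proof.
move=> sGF /partition_facesP[i [lam [g [le_im lamP sF]]]].
by apply/partition_facesP; exists i, lam, g; rewrite (subset_trans sGF).
Qed.

Definition partition_complex (m : nat) : complex pvertex :=
  Complex (@partition_closed m).

End PartitionComplex.

(* Main.v *)
Require Import Defs.
From mathcomp Require Import all_boot all_order all_fingroup all_algebra.
From mathcomp Require Import zify.

(** A set F of vertices is encoded by the set [xset F] of positions r with x_r
    in F and by the height at r, the largest j with y_r^j in F (0 if none); let
    [ysupp F] be the set of positions of positive height. Then F is a face iff
    [xset F] and [ysupp F] are disjoint, #|ysupp F| <= m, the sum over r of the
    truncated differences (height - 1) is at most a - 2, and [xset F] is not the
    set of all positions.

    The link of S is handled by discrete Morse theory: the faces containing S
    are matched by toggling vertices. If the y's of S in some column are not an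
    initial segment, the link is a cone. Otherwise:
    - more than m positions outside [xset S]: toggle x_r for the first position r
      outside [xset S] of height 0; the only possible critical face consists of
      all x's but one, and then [ysupp S] is empty;
    - at most m such positions and [ysupp S] empty: toggle y_r^1 for the first r
      with x_r absent; nothing is critical;
    - at most m such positions and r0 in [ysupp S]: toggle the first vertex above
      S in column r0 if the other columns do not exhaust the bound a - 2; else
      toggle the vertex just below the top of a column that exceeds S by at least
      two; else toggle some x; the critical faces are facets, of size p + a - 1.
    In each case the critical faces all have the same size, so the homology of
    the link is nonzero in exactly one degree as soon as one of them exists. *)

Set Implicit Arguments.
Unset Strict Implicit.
Unset Printing Implicit Defensive.

Import Order.TTheory GRing.Theory Num.Theory.
Local Open Scope ring_scope.

(** * Discrete Morse theory *)

Section Chains.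
Variables (K : fieldType) (V : finType).
Implicit Types (c e f : chain K V) (F G : {set V}) (D : complex V).

Lemma face_sign_neq0 (v : V) F : face_sign K v F != 0.
Proof. by rewrite /face_sign signr_eq0. Qed.

Lemma face_sign_sqr (v : V) F : face_sign K v F * face_sign K v F = 1.
Proof. by rewrite /face_sign -expr2 sqrr_sign. Qed.

Lemma chain_sumE I (r : seq I) (P : pred I) (E : I -> chain K V) G :
  (\sum_(i <- r | P i) E i : chain K V) G = \sum_(i <- r | P i) (E i G : K).
Proof. by rewrite sum_ffunE. Qed.

Lemma chain_scaleE (k : K) c G : (k *: c : chain K V) G = k * c G.
Proof. by rewrite ffunE. Qed.

Lemma face_chainE F G : face_chain K F G = (G == F)%:R.
Proof. by rewrite ffunE. Qed.

Lemma boundaryE c G :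
  boundary K V c G = \sum_(v | v \notin G) face_sign K v (v |: G) * c (v |: G).
Proof.
rewrite lfunE /= /boundary_fun chain_sumE.
transitivity (\sum_(F : {set V}) \sum_(v in F)
    (if (v \notin G) && (v |: G == F) then face_sign K v (v |: G) * c (v |: G)
     else 0)).
  apply: eq_bigr => F _; rewrite chain_scaleE chain_sumE mulr_sumr.
  apply: eq_bigr => v vF; rewrite chain_scaleE face_chainE.
  have [->|neG] := eqVneq G (F :\ v).
    by rewrite setD1K // !inE !eqxx /= mulr1 mulrC.
  case: andP => [[vG /eqP eF]|_]; last by rewrite !mulr0.
  by case/eqP: neG; rewrite -eF setU1K.
rewrite (exchange_big_dep predT) //= [RHS]big_mkcond /=.
apply: eq_bigr => v _; case: ifPn => vG /=; last by rewrite big1.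
rewrite -big_mkcondr /= (big_pred1 (v |: G)) // => F /=.
by rewrite eq_sym; case: eqP => [->|]; rewrite ?setU11 ?andbF.
Qed.

(** Faces are counted by cardinality, one more than the dimension, which keeps the Morse arguments
    in [nat]. *)
Definition chain_on D i c := forall F, c F != 0 -> F \in D /\ #|F| = i.

Lemma chainsP D i c :
  reflect (chain_on D i c) (c \in chains K D (i%:Z - 1)).
Proof.
have dimE F : (face_dim F == i%:Z - 1) = (#|F| == i).
  by rewrite /face_dim (inj_eq (addIr _)).
apply: (iffP idP) => [|supp].
  move=> /(@coord_span _ _ _ (in_tuple _)); set s := image _ _ => ec F cF.
  have sD e : e \in s -> e F != 0 -> F \in D /\ #|F| = i.
    move=> /mapP[G Gin ->]; rewrite face_chainE.
    move: Gin; rewrite mem_enum inE dimE => /andP[DG /eqP szG].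
    by case: (eqVneq F G) => [->|]; rewrite ?eqxx.
  have [/existsP[j]|/existsPn z] :=
    boolP [exists j : 'I_(size s), (s`_j : chain K V) F != 0].
    by apply: sD; apply: mem_nth.
  case/eqP: cF; rewrite ec chain_sumE big1 // => j _.
  by have /negPn/eqP z0 := z j; rewrite chain_scaleE z0 mulr0.
have -> : c = \sum_F (c F : K) *: face_chain K F.
  apply/ffunP=> G; rewrite chain_sumE (bigD1 G) //= big1 => [|F /negPf nFG].
    by rewrite chain_scaleE face_chainE eqxx addr0 mulr1.
  by rewrite chain_scaleE face_chainE eq_sym nFG mulr0.
apply: memv_suml => F _; have [->|/supp[DF szF]] := eqVneq (c F) 0.
  by rewrite scale0r mem0v.
apply/memvZ/memv_span/image_f.
by rewrite inE DF dimE szF eqxx.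
Qed.

Lemma homology_eq0P D i :
  reflect (forall c : chain K V, chain_on D i c -> boundary K V c = 0 ->
             exists2 e : chain K V, chain_on D i.+1 e & boundary K V e = c)
          (homology K D (i%:Z - 1) == 0%VS).
Proof.
have i1 : i%:Z - 1 + 1 = i.+1%:Z - 1 by lia.
rewrite diffv_eq0; apply: (iffP subvP) => [sub c /chainsP cD bc0|ex c].
  have /sub/memv_imgP[e] : c \in cycles K D (i%:Z - 1).
    by rewrite memv_cap cD memv_ker bc0 eqxx.
  by rewrite i1 => /chainsP eD ->; exists e.
rewrite memv_cap memv_ker => /andP[/chainsP cD /eqP bc0].
have [e eD <-] := ex c cD bc0.
by apply/memv_imgP; exists e => //; rewrite i1; apply/chainsP.
Qed.

Lemma chain_onD D i c e : chain_on D i c -> chain_on D i e -> chain_on D i (c + e).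
Proof.
move=> cD eD F; rewrite ffunE => nz.
have [c0|/cD//] := eqVneq (c F) 0; apply: eD.
by apply: contraNneq nz => e0; rewrite c0 e0 addr0.
Qed.

Lemma chain_onN D i c : chain_on D i c -> chain_on D i (- c).
Proof. by move=> cD F; rewrite ffunE oppr_eq0 => /cD. Qed.

Lemma boundary_neq0 c G :
  boundary K V c G != 0 -> exists2 v, v \notin G & c (v |: G) != 0.
Proof.
rewrite boundaryE => nz; have [/exists_inP[v]|/exists_inPn z] :=
  boolP [exists v in predC (mem G), c (v |: G) != 0]; first by exists v.
by case/eqP: nz; rewrite big1 // => v /z/negPn/eqP ->; rewrite mulr0.
Qed.

Lemma chain_on_boundary D i c : chain_on D i.+1 c -> chain_on D i (boundary K V c).
Proof.
move=> cD G /boundary_neq0[v vG /cD[Dv]]; rewrite cardsU1 vG => -[szG].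
by split=> //; apply: faces_closed Dv; apply: subsetUr.
Qed.

End Chains.

(** * Cancellation of chains along an acyclic matching *)

Section Morse.
Variables (K : fieldType) (V : finType).
Implicit Types (c e f : chain K V) (F G : {set V}) (D : complex V).

(** A cluster-lemma form of acyclicity: [rk] is monotone and [w] is constant along inclusions inside
    a fibre of [rk], so toggling [w F] pairs faces of equal rank; [None] marks the critical
    faces. *)
Definition acyclic_matching D (rk : {set V} -> nat) (w : {set V} -> option V) :=
  [/\ forall F G, F \in D -> G \subset F -> (rk G <= rk F)%N,
      forall F G, F \in D -> G \subset F -> rk G = rk F -> w G = w F
    & forall F v, F \in D -> w F = Some v ->
        [/\ v |: F \in D, rk (v |: F) = rk F & rk (F :\ v) = rk F]].

Variables (D : complex V) (rk : {set V} -> nat) (w : {set V} -> option V).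

(* Off the critical faces the part of [c] of rank [t] is cancelled by coning with
   the toggled vertices. *)
Lemma morse_step i t c :
  acyclic_matching D rk w -> chain_on D i c ->
  (forall F, c F != 0 -> (rk F <= t)%N) ->
  (forall F, boundary K V c F != 0 -> (rk F < t)%N) ->
  (forall F, F \in D -> #|F| = i -> w F <> None) ->
  exists e : chain K V,
    [/\ chain_on D i.+1 e, forall F, e F != 0 -> (rk F <= t)%N
      & forall F, (c - boundary K V e) F != 0 -> (rk F < t)%N].
Proof.
case=> rkS wS wP cD crk bcrk ncrit.
(* The cone over the rank-[t] part of [c]; the sign makes the boundary of [e] return the coefficient
   of [c] at [F :\ v]. *)
pose e : chain K V := [ffun F => if w F is Some v then
  if [&& F \in D, rk F == t & v \in F] then face_sign K v F * c (F :\ v) else 0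
  else 0].
have e_neq0 F : e F != 0 -> exists v,
    [/\ w F = Some v, F \in D, rk F = t, v \in F & c (F :\ v) != 0].
  rewrite ffunE; case: (w F) => [v|]; last by rewrite eqxx.
  case: and3P => [[DF /eqP rkF vF]|]; last by rewrite eqxx.
  by rewrite mulf_eq0 (negPf (face_sign_neq0 _ _ _)) => nz; exists v.
have eD : chain_on D i.+1 e.
  move=> F /e_neq0[v [_ DF _ vF /cD[_ <-]]].
  by split; rewrite // (cardsD1 v F) vF.
have erk F : e F != 0 -> (rk F <= t)%N by case/e_neq0=> v [_ _ ->].
exists e; split=> //.
set c' := c - _; have c'rk F : c' F != 0 -> (rk F <= t)%N.
  rewrite !ffunE => nz; have [c0|/crk//] := eqVneq (c F) 0.
  move: nz; rewrite c0 sub0r oppr_eq0 => /boundary_neq0[v vF nzv].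
  have [u [_ DvF <- _ _]] := e_neq0 _ nzv.
  by apply: rkS => //; apply: subsetUr.
have c'D : chain_on D i c'.
  by apply: chain_onD => //; apply/chain_onN/chain_on_boundary.
(* Among the cofaces of such an [F], only [v |: F] can lie in the support of [e]: any other one of
   rank [t] has the same toggled vertex [v] and does not contain it. *)
have c'_out F v : F \in D -> rk F = t -> w F = Some v -> v \notin F -> c' F = 0.
  move=> DF rkF wF vF; rewrite !ffunE boundaryE (bigD1 v) //= big1 => [|u].
    have [DvF rkvF _] := wP _ _ DF wF.
    have wvF : w (v |: F) = Some v by rewrite -(wS _ F) // subsetUr.
    rewrite addr0 ffunE wvF DvF rkvF rkF eqxx setU11 /= mulrA face_sign_sqr.
    by rewrite mul1r setU1K // subrr.
  case/andP=> uF uv; have [->|] := eqVneq (e (u |: F)) 0; first by rewrite mulr0.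
  case/e_neq0=> v' [wuF DuF rkuF]; rewrite !inE => /orP[/eqP ev|].
    have : w F = w (u |: F) by apply: wS; rewrite ?subsetUr ?rkF ?rkuF.
    by rewrite wuF wF => -[ev']; rewrite ev' ev eqxx in uv.
  have : w F = w (u |: F) by apply: wS; rewrite ?subsetUr ?rkF ?rkuF.
  by rewrite wuF wF => -[<-]; rewrite (negPf vF).
move=> F nz; rewrite ltn_neqAle c'rk // andbT; apply: contra_neqN nz => /eqP rkF.
have [//|nz] := eqVneq (c' F) 0; have [DF szF] := c'D _ nz.
case wF: (w F) => [v|]; last by case: (ncrit _ DF szF).
have [vF|vF] := boolP (v \in F); last exact: (c'_out _ _ DF rkF wF).
have [_ _ rkFv] := wP _ _ DF wF.
(* The other cofaces of [F :\ v] miss [v], so [c'_out] kills their terms and this equation leaves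
   [c' F] alone. *)
have bc' : boundary K V c' (F :\ v) = 0.
  rewrite linearB /= boundaryK subr0; apply/eqP/negPn/negP => /bcrk.
  by rewrite rkFv rkF ltnn.
move: bc'; rewrite boundaryE (bigD1 v) ?setD11 //= setD1K // big1 ?addr0.
  by move/eqP; rewrite mulf_eq0 (negPf (face_sign_neq0 _ _ _)) => /eqP.
move=> u /andP[uFv uv]; have [->|nzu] := eqVneq (c' (u |: F :\ v)) 0.
  by rewrite mulr0.
have [Du _] := c'D _ nzu.
have rku : rk (u |: F :\ v) = t.
  by apply/eqP; rewrite eqn_leq c'rk //= -rkF -rkFv rkS ?subsetUr.
rewrite (c'_out _ v) ?mulr0 //; last by rewrite !inE eqxx /= orbF eq_sym.
rewrite -(wS _ (F :\ v)) ?subsetUr ?rkFv ?rkF ?rku //.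
by rewrite -wF; apply: wS; rewrite ?subD1set ?rkFv.
Qed.

(** [morse_step] is iterated from rank [n] down to [t]; subtracting a boundary does not change the
    boundary of the chain, so the hypothesis on it persists. *)
Lemma morse_push i n t c :
  acyclic_matching D rk w -> chain_on D i c -> (t <= n)%N ->
  (forall F, c F != 0 -> (rk F < n)%N) ->
  (forall F, boundary K V c F != 0 -> (rk F < t)%N) ->
  (forall F, F \in D -> #|F| = i -> w F <> None) ->
  exists e : chain K V,
    [/\ chain_on D i.+1 e, forall F, e F != 0 -> (rk F < n)%N
      & forall F, (c - boundary K V e) F != 0 -> (rk F < t)%N].
Proof.
move=> Dw + + + + ncrit.
elim: n c => [|n IHn] c cD; first rewrite leqn0 => /eqP->.
  move=> crk _; exists 0; split=> [F|F|F]; rewrite ?linear0 ?addr0.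
  - by rewrite ffunE eqxx.
  - by rewrite ffunE eqxx.
  exact: crk.
rewrite leq_eqVlt => /predU1P[->|lt_tn] crk bcrk.
  exists 0; split=> [F|F|F]; rewrite ?linear0 ?addr0; last exact: crk.
  - by rewrite ffunE eqxx.
  by rewrite ffunE eqxx.
have [e [eD erk c'rk]] : exists e : chain K V,
    [/\ chain_on D i.+1 e, forall F, e F != 0 -> (rk F <= n)%N
      & forall F, (c - boundary K V e) F != 0 -> (rk F < n)%N].
  by apply: morse_step => // F /bcrk rkF; apply: leq_trans rkF _.
have c'D : chain_on D i (c - boundary K V e).
  by apply: chain_onD => //; apply/chain_onN/chain_on_boundary.
have [||e' [e'D e'rk c''rk]] := IHn _ c'D _ c'rk => //.
  by move=> F; rewrite linearB /= boundaryK subr0; apply: bcrk.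
exists (e + e'); split=> [|F|F].
- exact: chain_onD.
- rewrite ffunE => nz; have [e0|/erk//] := eqVneq (e F) 0.
  by apply/ltnW/e'rk; apply: contraNneq nz => e'0; rewrite e0 e'0 addr0.
by rewrite linearD /= opprD addrA; apply: c''rk.
Qed.

Lemma chain_eq0 c : (forall F, c F = 0) -> c = 0.
Proof. by move=> z; apply/ffunP=> F; rewrite z ffunE. Qed.

(** Pushing down to [t = 0] leaves nothing. The rank bound on the filling is kept for
    [morse_nonvanish]. *)
Lemma morse_exact i n c :
  acyclic_matching D rk w -> chain_on D i c ->
  (forall F, c F != 0 -> (rk F < n)%N) -> boundary K V c = 0 ->
  (forall F, F \in D -> #|F| = i -> w F <> None) ->
  exists e : chain K V, [/\ chain_on D i.+1 e, boundary K V e = c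
                        & forall F, e F != 0 -> (rk F < n)%N].
Proof.
move=> Dw cD crk bc0 ncrit.
have [|e [eD erk e0]] := morse_push Dw cD (leq0n n) crk _ ncrit.
  by move=> F; rewrite bc0 ffunE eqxx.
exists e; split=> //; apply/esym/eqP; rewrite -subr_eq0; apply/eqP/chain_eq0=> F.
by apply/eqP/negPn/negP=> /e0.
Qed.

Lemma chain_rk_bound c t : exists2 n, (t <= n)%N & forall F, c F != 0 -> (rk F < n)%N.
Proof.
exists (maxn t (\max_(F : {set V}) (rk F)).+1); first exact: leq_maxl.
by move=> F _; rewrite leq_max ltnS (leq_bigmax F) orbT.
Qed.

Lemma morse_vanish i :
  acyclic_matching D rk w -> (forall F, F \in D -> #|F| = i -> w F <> None) ->
  homology K D (i%:Z - 1) = 0%VS.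
Proof.
move=> Dw ncrit; apply/eqP/homology_eq0P=> c cD bc0.
have [n _ crk] := chain_rk_bound c 0.
by have [e [eD <- _]] := morse_exact Dw cD crk bc0 ncrit; exists e.
Qed.

(** Filling the boundary of [F] in lower rank completes [F] to a cycle. If that cycle were a
    boundary, its filling could be pushed to rank at most [rk F], and would then contain a coface of
    [F] of the same rank, hence critical, but of size [i.+1]. *)
Lemma morse_nonvanish i F :
  acyclic_matching D rk w -> F \in D -> #|F| = i -> w F = None ->
  (forall G, G \in D -> w G = None -> #|G| = i) ->
  homology K D (i%:Z - 1) != 0%VS.
Proof.
move=> Dw DF szF wF crit; case: (Dw) => rkS wS wP; apply/homology_eq0P=> H0.
have [z [zD zF zrk bz0]] : exists z : chain K V,
    [/\ chain_on D i z, z F != 0, forall G, z G != 0 -> (rk G <= rk F)%N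
      & boundary K V z = 0].
  have fD : chain_on D i (face_chain K F).
    move=> G; rewrite face_chainE; case: (eqVneq G F) => [->//|].
    by rewrite eqxx.
  (* For [i = 0] the face is empty and is a cycle by itself. *)
  case: i szF crit fD H0 => [|i] szF crit fD H0.
    exists (face_chain K F); split=> [//||G|].
    - by rewrite face_chainE eqxx oner_eq0.
    - by rewrite face_chainE; case: (eqVneq G F) => [->//|]; rewrite eqxx.
    apply: chain_eq0 => G; apply/eqP/negPn/negP=> /boundary_neq0[v vG /fD[_]].
    by rewrite cardsU1 vG.
  (* A face of the boundary with the same rank as [F] would be critical too, with one vertex
     fewer. *)
  have bfrk G : boundary K V (face_chain K F) G != 0 -> (rk G < rk F)%N.
    move=> nz; have [DG szG] := chain_on_boundary fD nz.
    have [v vG] := boundary_neq0 nz; rewrite face_chainE.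
    have [eF _|_] := eqVneq (v |: G) F; last by rewrite eqxx.
    have sGF : G \subset F by rewrite -eF subsetUr.
    rewrite ltn_neqAle rkS // andbT; apply: contra_eqN szG => /eqP rkG.
    by rewrite (crit G) ?(wS _ _ DF sGF rkG) // gtn_eqF.
  have [||e [eD be erk]] := morse_exact Dw (chain_on_boundary fD) bfrk.
  - exact: boundaryK.
  - by move=> G DG szG /(crit G DG) szG'; rewrite szG' in szG; lia.
  have eF : e F = 0 by apply/eqP/negPn/negP=> /erk; rewrite ltnn.
  exists (face_chain K F - e); split=> [||G|].
  - exact/chain_onD/chain_onN.
  - by rewrite !ffunE eF eqxx subr0 oner_eq0.
  - rewrite !ffunE; case: (eqVneq G F) => [->//|_].
    by rewrite sub0r oppr_eq0 => /erk/ltnW.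
  by rewrite linearB /= be subrr.
have [g gD bg] := H0 z zD bz0.
have [n le_rn grk] := chain_rk_bound g (rk F).+1.
have [||e [eD erk g'rk]] := morse_push Dw gD le_rn grk.
- by move=> G; rewrite bg ltnS; apply: zrk.
- by move=> G DG szG /(crit G DG) szG'; rewrite szG' in szG; lia.
have : boundary K V (g - boundary K V e) F != 0.
  by rewrite linearB /= boundaryK subr0 bg.
case/boundary_neq0=> v vF nz.
have [DvF] : v |: F \in D /\ #|v |: F| = i.+1.
  by apply: (chain_onD gD) nz; apply/chain_onN/chain_on_boundary.
apply/eqP; rewrite (crit _ DvF) ?neq_ltn ?ltnS ?leqnn //.
rewrite -(wS _ F) ?subsetUr //; apply/eqP; rewrite eqn_leq rkS ?subsetUr //=.
exact: g'rk.
Qed.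

End Morse.

(** * Matchings on links *)

Section LinkMorse.
Variables (K : fieldType) (V : finType) (D : complex V) (S : {set V}).
Implicit Types F G : {set V}.

(** Stated on the faces of [D] containing [S], so that a matching may use the whole face;
    [v \notin S] keeps toggling among them. *)
Definition link_matching (rk : {set V} -> nat) (w : {set V} -> option V) :=
  [/\ forall F G, F \in D -> S \subset G -> G \subset F -> (rk G <= rk F)%N,
      forall F G, F \in D -> S \subset G -> G \subset F -> rk G = rk F -> w G = w F
    & forall F v, F \in D -> S \subset F -> w F = Some v ->
        [/\ v \notin S, v |: F \in D, rk (v |: F) = rk F & rk (F :\ v) = rk F]].

Variables (rk : {set V} -> nat) (w : {set V} -> option V).

Lemma mem_link F : (F \in link D S) = (S :&: F == set0) && (S :|: F \in D).
Proof.
rewrite !inE; case: (boolP (S :|: F \in D)) => [SF|]; last by rewrite !andbF.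
by rewrite (faces_closed (subsetUr S F) SF).
Qed.

Lemma link_matchingP :
  link_matching rk w ->
  acyclic_matching (link D S) (fun F => rk (S :|: F)) (fun F => w (S :|: F)).
Proof.
case=> rkS wS wP; split=> [F G|F G|F v]; rewrite mem_link => /andP[/eqP SF0 SF].
- by move=> sGF; apply: rkS; rewrite ?subsetUl ?setUS.
- by move=> sGF; apply: wS; rewrite ?subsetUl ?setUS.
case/(wP _ _ SF (subsetUl _ _)) => vS DvF rkv rkv'.
have eU : S :|: (v |: F) = v |: (S :|: F) by rewrite setUCA.
have eD : S :|: F :\ v = (S :|: F) :\ v.
  by apply/setP=> u; rewrite !inE; case: eqP => [->|//]; rewrite (negPf vS).
rewrite mem_link eU eD DvF andbT setIUr SF0 setU0; split=> //.
by rewrite setI_eq0 disjoint_sym disjoints1.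
Qed.

Lemma link_nonzero_critical i :
  link_matching rk w -> homology K (link D S) (i%:Z - 1) != 0%VS ->
  exists F, [/\ F \in D, S \subset F, w F = None & #|F| = (#|S| + i)%N].
Proof.
move=> Sw; case: (boolP [exists F in D, [&& S \subset F, w F == None
    & #|F| == (#|S| + i)%N]]) => [/exists_inP[F DF /and3P[SF /eqP wF /eqP szF]] _|].
  by exists F.
move=> /exists_inPn ncrit; case/eqP; apply: (morse_vanish K (link_matchingP Sw)).
move=> F; rewrite mem_link => /andP[/eqP SF0 SF] szF wF.
case/and3P: (ncrit _ SF); split; [exact: subsetUl|exact/eqP|].
by rewrite cardsU SF0 cards0 subn0 szF.
Qed.

Lemma link_critical_nonzero F :
  link_matching rk w -> F \in D -> S \subset F -> w F = None ->
  (forall G, G \in D -> S \subset G -> w G = None -> #|G| = #|F|) ->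
  homology K (link D S) ((#|F| - #|S|)%N%:Z - 1) != 0%VS.
Proof.
move=> Sw DF SF wF crit.
have eF : S :|: F :\: S = F.
  by rewrite -[RHS](setID F S) (setIidPr SF).
have szD : #|F :\: S| = (#|F| - #|S|)%N by rewrite cardsD (setIidPr SF).
apply: (morse_nonvanish K (link_matchingP Sw) _ szD); rewrite ?eF //.
  rewrite mem_link eF DF andbT; apply/eqP/setP=> u; rewrite !inE.
  by case: (u \in S).
move=> G; rewrite mem_link => /andP[/eqP SG0 SG] /(crit _ SG (subsetUl _ _)) <-.
by rewrite cardsU SG0 cards0 subn0 addKn.
Qed.

End LinkMorse.

(** * Faces and heights *)

Section Heights.
Variables a p : nat.
Implicit Types (F G : {set pvertex a p}) (r : 'I_p.+1) (j : 'I_a.-1).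

Definition xset F : {set 'I_p.+1} := [set r | inl r \in F].

Definition height F r : nat := \max_(j | inr (r, j) \in F) j.+1.

Definition ysupp F : {set 'I_p.+1} := [set r | (0 < height F r)%N].

Lemma height_gt F r j : inr (r, j) \in F -> (j < height F r)%N.
Proof.
move=> Fj.
exact: (@leq_bigmax_cond _ (fun i => inr (r, i) \in F) (fun i : 'I_a.-1 => i.+1)).
Qed.

Lemma height_leP F r k :
  reflect (forall j, inr (r, j) \in F -> (j < k)%N) (height F r <= k)%N.
Proof. exact: bigmax_leqP. Qed.

Lemma height_mem F r :
  (0 < height F r)%N -> exists2 j, inr (r, j) \in F & j.+1 = height F r.
Proof.
move=> h0; case: (pickP (fun j => inr (r, j) \in F)) => [j Fj|F0].
  have [|i Fi hi] := @eq_bigmax_cond _ [pred j | inr (r, j) \in F] (fun j => j.+1).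
    by apply/card_gt0P; exists j.
  by exists i.
by move: h0; rewrite /height big_pred0.
Qed.

Lemma height_bound F r : (height F r <= a.-1)%N.
Proof. by apply/height_leP=> j _. Qed.

Lemma heightS F G r : G \subset F -> (height G r <= height F r)%N.
Proof. by move=> /subsetP sGF; apply/height_leP=> j /sGF; apply: height_gt. Qed.

Lemma xsetS F G : G \subset F -> xset G \subset xset F.
Proof. by move=> /subsetP sGF; apply/subsetP=> r; rewrite !inE => /sGF. Qed.

Lemma ysuppS F G : G \subset F -> ysupp G \subset ysupp F.
Proof.
by move=> sGF; apply/subsetP=> r; rewrite !inE => /leq_trans; apply; apply: heightS.
Qed.

Lemma eq_ysupp F G : height F =1 height G -> ysupp F = ysupp G.
Proof. by move=> eh; apply/setP=> r; rewrite !inE eh. Qed.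

Lemma notin_ysupp F r : (r \notin ysupp F) = (height F r == 0%N).
Proof. by rewrite inE lt0n negbK. Qed.

Lemma xset_addx F r : xset (inl r |: F) = r |: xset F.
Proof. by apply/setP=> s; rewrite !inE. Qed.

Lemma xset_delx F r : xset (F :\ inl r) = xset F :\ r.
Proof. by apply/setP=> s; rewrite !inE. Qed.

Lemma xset_addy F u : xset (inr u |: F) = xset F.
Proof. by apply/setP=> s; rewrite !inE. Qed.

Lemma xset_dely F u : xset (F :\ inr u) = xset F.
Proof. by apply/setP=> s; rewrite !inE. Qed.

Lemma height_addx F r : height (inl r |: F) =1 height F.
Proof. by move=> s; apply: eq_bigl => j; rewrite !inE. Qed.

Lemma height_delx F r : height (F :\ inl r) =1 height F.
Proof. by move=> s; apply: eq_bigl => j; rewrite !inE. Qed.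

Lemma height_addy F r j s :
  height (inr (r, j) |: F) s = if s == r then maxn j.+1 (height F r) else height F s.
Proof.
case: eqVneq => [->|/negPf nsr].
  apply/eqP; rewrite eqn_leq geq_max height_gt ?setU11 // heightS ?subsetUr //.
  rewrite !andbT; apply/height_leP=> i; rewrite !inE => /orP[/eqP[->]|/height_gt].
    exact: leq_maxl.
  by move/leq_trans; apply; apply: leq_maxr.
by apply: eq_bigl => i; rewrite !inE (inj_eq inr_inj) xpair_eqE nsr.
Qed.

Lemma height_dely F r j s :
  (s != r) || (j.+1 < height F r)%N -> height (F :\ inr (r, j)) s = height F s.
Proof.
case: (eqVneq s r) => [->|/negPf nsr _] /=.
  move=> ltj; apply/eqP; rewrite eqn_leq heightS ?subD1set //=.
  have [i Fi ei] := @height_mem F r (leq_ltn_trans (leq0n _) ltj).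
  rewrite -ei height_gt // !inE Fi andbT (inj_eq inr_inj) xpair_eqE eqxx /=.
  by apply: contraTneq ltj => <-; rewrite -ei ltnn.
by apply: eq_bigl => i; rewrite !inE (inj_eq inr_inj) xpair_eqE nsr.
Qed.

Lemma sum_ltn n k : (\sum_(i < n) (i < k) = minn n k)%N.
Proof.
elim: n => [|n IHn]; first by rewrite big_ord0 min0n.
by rewrite big_ord_recr /= IHn; case: ltnP; lia.
Qed.

Lemma card_ltn n k : #|[set i : 'I_n | (i < k)%N]| = minn n k.
Proof.
rewrite -sum1_card big_mkcond -sum_ltn; apply: eq_bigr => i _.
by rewrite inE; case: (i < k)%N.
Qed.

Definition initial F := forall r j, (j < height F r)%N -> inr (r, j) \in F.

Lemma card_initial F :
  initial F -> #|F| = (#|xset F| + \sum_r height F r)%N.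
Proof.
move=> Fini; rewrite -!sum1_card big_mkcond big_sumType /=; congr (_ + _)%N.
  by rewrite [RHS]big_mkcond; apply: eq_bigr => r _; rewrite inE.
transitivity (\sum_r \sum_(j : 'I_a.-1) if inr (r, j) \in F then 1 else 0)%N.
  by rewrite pair_bigA /=; apply: eq_bigr => -[].
apply: eq_bigr => r _; rewrite -[RHS](minn_idPr (height_bound F r)) -sum_ltn.
apply: eq_bigr => j _; have [/height_gt->//|nF] := ifPn.
by case: ltnP => // /Fini; rewrite (negPf nF).
Qed.

Definition layers (X : {set 'I_p.+1}) (c : 'I_p.+1 -> nat) : {set pvertex a p} :=
  [set v : pvertex a p | match v with inl r => r \in X | inr (r, j) => (j < c r)%N end].

Lemma xset_layers X c : xset (layers X c) = X.
Proof. by apply/setP=> r; rewrite !inE. Qed.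

Lemma height_layers X c r : height (layers X c) r = minn a.-1 (c r).
Proof.
apply/eqP; rewrite eqn_leq leq_min height_bound /=; apply/andP; split.
  by apply/height_leP=> j; rewrite inE.
case m0: (minn a.-1 (c r)) => [//|k].
have lek : (k < minn a.-1 (c r))%N by rewrite m0.
have lta : (k < a.-1)%N by rewrite (leq_trans lek) ?geq_minl.
by apply: (@height_gt _ _ (Ordinal lta)); rewrite inE (leq_trans lek) ?geq_minr.
Qed.

Lemma layers_initial X c : initial (layers X c).
Proof. by move=> r j; rewrite height_layers leq_min inE => /andP[]. Qed.

Lemma card_layers X c : #|layers X c| = (#|X| + \sum_r minn a.-1 (c r))%N.
Proof.
rewrite (card_initial (@layers_initial X c)) xset_layers; congr (_ + _)%N.
by apply: eq_bigr => r _; rewrite height_layers.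
Qed.

Lemma sum_pred_nth (lam : seq nat) n :
  all (ltn 0%N) lam -> (\sum_(k < n) (nth 0 lam k - 1) + size lam <= sumn lam)%N.
Proof.
elim: lam n => [|k lam IH] n /=.
  by rewrite addn0 big1 // => k _; rewrite nth_nil.
case/andP=> k0 lam0; case: n => [|n].
  by have := IH 0%N lam0; rewrite !big_ord0; lia.
have := IH n lam0; rewrite big_ord_recl; case: k k0 => // k _.
by rewrite subn1 /= -addnA !addnS addSn ltnS leq_add2l.
Qed.

(** Up to [g], column [k] is bounded by the part of index [k], which is zero from [i] on. The bound
    [a - 2] is the total [a + i - 2] less one for each of the [i] parts. *)
Lemma partition_face_conditions m F :
  F \in partition_complex a p m ->
  [/\ [disjoint xset F & ysupp F], (#|ysupp F| <= m)%N,
      (\sum_r (height F r - 1) <= a - 2)%N & xset F != setT].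
Proof.
case/partition_facesP=> i [lam [g [/andP[i0 lem] /and4P[_ lam0 /eqP szl /eqP suml]]]].
move=> /subsetP sF.
have xF k : g k \in xset F -> (i <= k)%N.
  rewrite inE => /sF/imsetP[[k'|[r j]]]; rewrite inE //= => le [/perm_inj ->].
  exact: le.
have hF k : (height F (g k) <= nth 0 lam k)%N.
  apply/height_leP=> j /sF/imsetP[[k'|[r j']]]; rewrite inE //=.
  by move=> /andP[_ le] [/perm_inj -> ->].
have hF0 (k : 'I_p.+1) : (i <= k)%N -> height F (g k) = 0%N.
  by move=> le; apply/eqP; rewrite -leqn0 (leq_trans (hF k)) // nth_default ?szl.
split.
- rewrite disjoint_subset; apply/subsetP=> r; rewrite -(permKV g r) => /xF le.
  by rewrite inE notin_ysupp hF0.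
- apply: leq_trans lem; have sY : ysupp F \subset g @: [set k : 'I_p.+1 | (k < i)%N].
    apply/subsetP=> r; rewrite -(permKV g r) => Yr; apply: imset_f.
    by rewrite inE ltnNge; apply: contraL Yr => /hF0; rewrite notin_ysupp => ->.
  apply: leq_trans (subset_leq_card sY) _; rewrite card_imset; last exact: perm_inj.
  by rewrite card_ltn geq_minr.
- rewrite (reindex_inj (@perm_inj _ g)) /=.
  have le : (\sum_k (height F (g k) - 1) <= \sum_(k < p.+1) (nth 0 lam k - 1))%N.
    by apply: leq_sum => k _; apply: leq_sub2r.
  by apply: leq_trans le _; have := sum_pred_nth p.+1 lam0; rewrite suml szl; lia.
apply/eqP=> xT; have /xF : g ord0 \in xset F by rewrite xT inE.
by rewrite leqNgt i0.
Qed.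

Lemma conditions_partition_face m F : (2 <= a)%N -> (1 <= m)%N ->
  [disjoint xset F & ysupp F] -> (#|ysupp F| <= m)%N ->
  (\sum_r (height F r - 1) <= a - 2)%N -> xset F != setT ->
  F \in partition_complex a p m.
Proof.
move=> a2 m1 dis leY sumh xT.
(* At least one part is required; if no y occurs, a single position without x provides it. *)
have [I [I0 leI disI sYI]] : exists I : {set 'I_p.+1},
    [/\ (0 < #|I|)%N, (#|I| <= m)%N, forall r, r \in xset F -> r \notin I
      & ysupp F \subset I].
  have [Y0|/set0Pn[r Yr]] := eqVneq (ysupp F) set0.
    move: xT; rewrite -subTset => /subsetPn[r _ nr]; exists [set r].
    rewrite cards1 Y0 sub0set; split=> // s xs; rewrite inE.
    by apply: contraNneq nr => <-.
  exists (ysupp F); split=> //; first by apply/card_gt0P; exists r.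
  by move=> s xs; apply/negP=> ys; move/pred0P/(_ s): dis; rewrite /= xs ys.
pose H r := maxn (height F r) 1.
pose slack := (a - 2 - \sum_r (height F r - 1))%N.
pose s := sort (fun r r' => H r' <= H r)%N (enum I).
have szs : size s = #|I| by rewrite size_sort -cardE.
have mems r : (r \in s) = (r \in I) by rewrite mem_sort mem_enum.
have us : uniq s by rewrite sort_uniq enum_uniq.
have ss : sorted (fun r r' => H r' <= H r)%N s.
  by apply: sort_sorted => r r'; apply: leq_total.
have sumH : (\sum_(r <- s) H r + slack = a + #|I| - 2)%N.
  rewrite (perm_big (enum I)) /=; last by rewrite perm_sort.
  rewrite big_enum /= (eq_bigr (fun r => height F r - 1 + 1)%N) => [|r _]; last first.
    by rewrite /H; lia.
  rewrite big_split /= sum1_card.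
  have -> : (\sum_(r in I) (height F r - 1) = \sum_r (height F r - 1))%N.
    rewrite [RHS](bigID (mem I)) /= [X in (_ + X)%N]big1 ?addn0 // => r nIr.
    have : r \notin ysupp F by apply: contra nIr; apply: (subsetP sYI).
    by rewrite notin_ysupp => /eqP->.
  by rewrite addnAC subnKC // addnBAC.
case es : s => [|r0 s']; first by move: I0; rewrite -szs es.
pose lam := (H r0 + slack)%N :: map H s'.
(* The permutation sends the first positions to [I] by decreasing height, and the remaining ones to
   its complement. *)
pose t := s ++ enum (~: I).
have szt : size t = p.+1.
  by rewrite size_cat szs -cardE cardsC card_ord.
have ut : uniq t.
  rewrite cat_uniq us enum_uniq andbT; apply/hasPn=> r.
  by rewrite mem_enum mems inE.
have memt r : r \in t by rewrite mem_cat mems mem_enum inE orbN.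
have inj_t : injective (fun k : 'I_p.+1 => nth r0 t k).
  move=> k k' /eqP; rewrite nth_uniq ?szt ?ltn_ord // => /eqP; exact: val_inj.
pose g := perm inj_t.
have ltt r : (index r t < p.+1)%N by rewrite -[X in (_ < X)%N]szt index_mem.
have gE r : g (Ordinal (ltt r)) = r by rewrite permE /= nth_index.
apply/partition_facesP; exists #|I|, lam, g; split; first by rewrite I0.
  apply/and4P; split.
  - move: ss; rewrite es /lam; case: (s') => //= r1 s'' /andP[le].
    by rewrite path_map => ->; rewrite andbT (leq_trans le) ?leq_addr.
  - rewrite /= addn_gt0 /H leq_max orbT /= all_map; apply/allP=> r _ /=.
    by rewrite leq_max orbT.
  - by rewrite /= size_map -szs es.
  - by move: sumH; rewrite es big_cons /= sumnE big_map; lia.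
have lamE r : r \in I -> (H r <= nth 0 lam (index r s))%N.
  rewrite -mems es inE /lam /= (eq_sym r0).
  case: (eqVneq r r0) => [-> _|_] /=; first exact: leq_addr.
  by move=> rs'; rewrite (nth_map r0) ?index_mem // nth_index.
apply/subsetP=> -[r|[r j]] Fv; apply/imsetP.
  exists (inl (Ordinal (ltt r))); last by rewrite /= gE.
  have nIr : r \notin I by apply: disI; rewrite inE.
  by rewrite inE /= index_cat mems (negPf nIr) szs leq_addr.
have h_gt := height_gt Fv.
have Ir : r \in I by apply: (subsetP sYI); rewrite inE (leq_trans _ h_gt).
exists (inr (Ordinal (ltt r), j)); last by rewrite /= gE.
rewrite inE /= index_cat mems Ir; apply/andP; split.
  by rewrite -ltnS subn1 prednK // -szs index_mem mems.
apply: leq_trans (lamE _ Ir); apply: leq_trans h_gt _; exact: leq_maxl.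
Qed.

End Heights.

(** * The matchings *)

Section Matchings.
Variables (b p m : nat).
Local Notation P := (partition_complex b.+2 p m).
Implicit Types (F G S : {set pvertex b.+2 p}) (r : 'I_p.+1).

Lemma partition_faceP F : (0 < m)%N ->
  reflect [/\ [disjoint xset F & ysupp F], (#|ysupp F| <= m)%N,
              (\sum_r (height F r - 1) <= b)%N & xset F != setT] (F \in P).
Proof.
move=> m0; apply: (iffP idP) => [/partition_face_conditions|[dis leY leh xT]].
  by rewrite subn2.
by apply: conditions_partition_face; rewrite ?subn2.
Qed.

Lemma eq_height_face F G : (0 < m)%N ->
  height G =1 height F -> xset G = xset F -> F \in P -> G \in P.
Proof.
move=> m0 eh eX /(partition_faceP _ m0)[dis leY leh xT].
apply/partition_faceP=> //; rewrite eX (eq_ysupp eh); split=> //.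
by under eq_bigr do rewrite eh.
Qed.

Lemma add_x_face F r : (0 < m)%N -> F \in P ->
  r \notin ysupp F -> r |: xset F != setT -> inl r |: F \in P.
Proof.
move=> m0 /(partition_faceP _ m0)[dis leY leh _] nY rxT.
have hF := height_addx F r.
apply/partition_faceP=> //; rewrite xset_addx (eq_ysupp hF); split=> //.
  by rewrite -setI_eq0 setIUl setU_eq0 !setI_eq0 disjoints1 nY dis.
by under eq_bigr do rewrite hF.
Qed.

Lemma add_x_neqT F r : (0 < m)%N -> F \in P ->
  r \notin ysupp F -> ysupp F != set0 -> r |: xset F != setT.
Proof.
move=> m0 /(partition_faceP _ m0)[dis _ _ _] nY /set0Pn[s Ys].
apply: contraTneq Ys => xT; have : s \in r |: xset F by rewrite xT inE.
by case/setU1P=> [->//|/(disjointFr dis)->].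
Qed.

Lemma sum_height F : (\sum_r height F r = \sum_r (height F r - 1) + #|ysupp F|)%N.
Proof.
rewrite -sum1_card [X in (_ + X)%N]big_mkcond -big_split /=.
by apply: eq_bigr => r _; rewrite inE; case: (height F r) => //= n; rewrite subn1 addn1.
Qed.

Lemma ysupp_card_lt F G :
  G \subset F -> ysupp G != ysupp F -> (#|ysupp G| < #|ysupp F|)%N.
Proof.
by move=> /ysuppS sY neY; apply: proper_card; rewrite properEneq neY.
Qed.

(** This is y_r^(k+1). The coercion [inord] is faithful only for [k <= b], whence the side
    conditions below. *)
Definition yvertex r k : pvertex b.+2 p := inr (r, inord k).

Lemma height_add_yvertex F r k s : (k <= b)%N ->
  height (yvertex r k |: F) s = if s == r then maxn k.+1 (height F r) else height F s.
Proof. by move=> lek; rewrite height_addy inordK. Qed.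

Lemma yvertex_notin F r k : (k <= b)%N -> (height F r <= k)%N -> yvertex r k \notin F.
Proof.
by move=> lek leh; apply: contraL leh => /height_gt; rewrite inordK // -ltnNge.
Qed.

Definition pick_out (A : {set 'I_p.+1}) := [pick r | r \notin A].

Variant pick_out_spec (A : {set 'I_p.+1}) : option 'I_p.+1 -> Prop :=
  | PickOut r of r \notin A : pick_out_spec A (Some r)
  | PickOutNone of A = setT : pick_out_spec A None.

Lemma pick_outP A : pick_out_spec A (pick_out A).
Proof.
rewrite /pick_out; case: pickP => [r nr|allA]; first exact: PickOut.
by apply: PickOutNone; apply/setP=> r; have /negbFE := allA r; rewrite inE.
Qed.

Lemma pick_out_some A r : pick_out A = Some r -> r \notin A.
Proof. by case: pick_outP => // s ns [<-]. Qed.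

(** The toggled vertex lies below the top of a column of [S], so no height changes and the face
    conditions are unaffected. *)
Lemma cone_matching S r j : (0 < m)%N ->
  inr (r, j) \notin S -> (j.+1 < height S r)%N ->
  link_matching P S (fun=> 0%N) (fun=> Some (inr (r, j))).
Proof.
move=> m0 nS ltj; split=> // F v DF SF [<-].
have hF : height (inr (r, j) |: F) =1 height F.
  move=> s; rewrite height_addy; case: eqP => [->|//].
  by apply/maxn_idPr/ltnW/(leq_trans ltj)/heightS.
by split=> //; apply: (eq_height_face m0 hF) DF; rewrite xset_addy.
Qed.

(** * Links with more than [m] positions outside [xset S] *)

Section ManyFree.
Variable S : {set pvertex b.+2 p}.

(** Adding x_r can only fail by completing the set of all x's, which requires that no y be present;
    this is the critical exception. *)
Definition many_toggle F : option (pvertex b.+2 p) :=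
  if pick_out (xset S :|: ysupp F) is Some r then
    if (ysupp F == set0) && (r |: xset F == setT) then None else Some (inl r)
  else None.

(* The second summand separates the critical face from the other faces
   without y-vertices. *)
Definition many_rank F : nat :=
  #|ysupp F| + ((ysupp F != set0) ||
    (if pick_out (xset S :|: ysupp F) is Some r then r |: xset F == setT else false)).

Lemma many_rank_lt F G :
  G \subset F -> ysupp G != ysupp F -> (many_rank G < many_rank F)%N.
Proof.
move=> sGF /(ysupp_card_lt sGF) ltY; rewrite /many_rank.
have -> : ysupp F != set0 by apply: contraTneq ltY => ->; rewrite cards0.
rewrite orTb [X in (_ < X)%N]addn1 ltnS; apply: leq_trans ltY.
by rewrite -[X in (_ <= X)%N]addn1 leq_add2l leq_b1.
Qed.

(** Nested faces of equal rank have the same [ysupp], hence the same picked position, and agree on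
    being critical. *)
Lemma many_matching : (0 < m)%N -> link_matching P S many_rank many_toggle.
Proof.
move=> m0; split=> [F G _ _ sGF|F G _ _ sGF|F v].
- have [eY|neY] := eqVneq (ysupp G) (ysupp F); last exact/ltnW/many_rank_lt.
  rewrite /many_rank eY leq_add2l; case: (ysupp F != set0) => //=.
  case: pick_out => // r; case: eqP => // xT; rewrite -subTset -xT.
  by rewrite setUS ?xsetS.
- have [eY|neY] := eqVneq (ysupp G) (ysupp F); last first.
    by move=> erk; have := many_rank_lt sGF neY; rewrite erk ltnn.
  rewrite /many_rank /many_toggle eY => /addnI; case: (ysupp F == set0) => //=.
  by case: pick_out => // r; do 2 case: eqP.
move=> DF SF; rewrite /many_toggle; case E : pick_out => [r|//].
have nr := pick_out_some E; case: ifPn => // ncrit [<-].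
have hF := height_addx F r; have hF' := height_delx F r.
move: nr; rewrite in_setU negb_or => /andP[nS nY].
have rxT : r |: xset F != setT.
  by move: ncrit; rewrite negb_and => /orP[/(add_x_neqT m0 DF nY)|].
split; [by rewrite inE in nS|exact: add_x_face| |].
  by rewrite /many_rank (eq_ysupp hF) E xset_addx setUA setUid.
rewrite /many_rank (eq_ysupp hF') E xset_delx; congr (_ + (_ || (_ == _)))%N.
by apply/setP=> s; rewrite !inE; case: eqP.
Qed.

Lemma many_critical F : (0 < m)%N -> (m < #|~: xset S|)%N ->
  F \in P -> many_toggle F = None -> ysupp F = set0 /\ #|F| = p.
Proof.
move=> m0 ltm /(partition_faceP _ m0)[dis leY _ xT]; rewrite /many_toggle.
case: pick_outP => [r nr|eT _].
  case: ifP => // /andP[/eqP Y0 /eqP rxT] _; split=> //.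
  have nrx : r \notin xset F.
    by apply: contra xT => rx; rewrite -rxT; apply/eqP/esym/setUidPr; rewrite sub1set.
  have hF s : height F s = 0%N by apply/eqP; rewrite -notin_ysupp Y0 inE.
  rewrite card_initial => [|s j]; last by rewrite hF.
  rewrite big1 ?addn0 => [|s _]; last exact: hF.
  by have := cardsU1 r (xset F); rewrite nrx rxT cardsT card_ord => -[].
suff /subset_leq_card : ~: xset S \subset ysupp F by rewrite leqNgt (leq_ltn_trans leY ltm).
apply/subsetP=> r; rewrite inE => nr.
by have : r \in setT by []; rewrite -eT in_setU (negPf nr).
Qed.

End ManyFree.

(** * Links with at most [m] positions outside [xset S] and no y in [S] *)

Section FewFree.
Variable S : {set pvertex b.+2 p}.

Definition few_toggle F : option (pvertex b.+2 p) :=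
  if pick_out (xset F) is Some r then Some (yvertex r 0) else None.

(** A first y in a column adds nothing to the truncated sum, and all y's stay over the at most [m]
    positions outside [xset S]. *)
Lemma few_matching : (0 < m)%N -> (#|~: xset S| <= m)%N -> ysupp S = set0 ->
  link_matching P S (fun F => #|xset F|) few_toggle.
Proof.
move=> m0 lem YS0; split=> [F G _ _ sGF|F G _ _ sGF eX|F v].
- exact/subset_leq_card/xsetS.
- rewrite /few_toggle; suff -> : xset G = xset F by [].
  by apply/eqP; rewrite eqEcard xsetS //= eX.
move=> /(partition_faceP _ m0)[dis leY leh xT] SF; rewrite /few_toggle.
case E : pick_out => [r|//] [<-]; have nr := pick_out_some E.
have hF s := height_add_yvertex F r s (leq0n b).
have dis' : [disjoint xset F & ysupp (yvertex r 0 |: F)].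
  rewrite disjoint_subset; apply/subsetP=> s xs; rewrite inE notin_ysupp hF.
  case: (eqVneq s r) => [es|_]; first by rewrite -es xs in nr.
  by rewrite -notin_ysupp (disjointFr dis xs).
have nS : yvertex r 0 \notin S.
  by apply: yvertex_notin; rewrite // leqn0 -notin_ysupp YS0 inE.
split=> //; last by rewrite xset_dely.
- apply/partition_faceP=> //; rewrite xset_addy; split=> //.
    apply: leq_trans lem; apply/subset_leq_card/subsetP=> s Ys; rewrite inE.
    by apply: contraL Ys => /(subsetP (xsetS SF)) xs; rewrite (disjointFr dis').
  rewrite (eq_bigr (fun s => height F s - 1)%N) // => s _; rewrite hF.
  by case: (eqVneq s r) => [->|//]; lia.
by rewrite xset_addy.
Qed.

Lemma few_toggle_neq0 F : (0 < m)%N -> F \in P -> few_toggle F <> None.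
Proof.
move=> m0 /(partition_faceP _ m0)[_ _ _ xT]; rewrite /few_toggle.
by case: pick_outP => // xT'; rewrite xT' eqxx in xT.
Qed.

End FewFree.

(** * Links of faces with a y in column [r0] *)

Section Tight.
Variables (S : {set pvertex b.+2 p}) (r0 : 'I_p.+1).

(** What [S] leaves of the bound [b = a - 2]. *)
Definition budget : nat := b - \sum_r (height S r - 1).

(** The maximum with 1 makes the first y of an empty column free of charge. *)
Definition extra F r : nat := height F r - maxn (height S r) 1.

Definition extras F : nat := \sum_(r | r != r0) extra F r.

(** Indices of [yvertex] start at 0: [height S r0] is the vertex just above [S] in column [r0], and
    [height F r - 2] the one just below the top of column [r]. *)
Definition tight_toggle F : option (pvertex b.+2 p) :=
  if (extras F < budget)%N then Some (yvertex r0 (height S r0))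
  else if [pick r | (height S r).+2 <= height F r]%N is Some r
    then Some (yvertex r (height F r - 2))
  else if pick_out (xset S :|: ysupp F) is Some r then Some (inl r) else None.

(** Column [r0] is omitted, so toggling there is invisible. Once the budget is exhausted, [ysupp]
    enters so that nested faces of equal rank have equal heights. *)
Definition tight_rank F : nat :=
  extras F + (budget <= extras F)%N * #|ysupp F|.

Lemma extraS F G r : G \subset F -> (extra G r <= extra F r)%N.
Proof. by move=> /heightS sGF; apply: leq_sub2r. Qed.

Lemma extrasS F G : G \subset F -> (extras G <= extras F)%N.
Proof. by move=> sGF; apply: leq_sum => r _; apply: extraS. Qed.

Lemma sum_extra F : S \subset F ->
  (\sum_r (height F r - 1) = \sum_r (height S r - 1) + (extras F + extra F r0))%N.
Proof.
move=> SF; have -> : (extras F + extra F r0 = \sum_r extra F r)%N.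
  by rewrite [RHS](bigD1 r0) //= addnC.
rewrite -big_split; apply: eq_bigr => r _ /=.
by have := heightS r SF; rewrite /extra; lia.
Qed.

Lemma extras_budget F : (0 < m)%N -> F \in P -> S \subset F ->
  (extras F + extra F r0 <= budget)%N.
Proof.
move=> m0 /(partition_faceP _ m0)[_ _ leh _] SF.
by rewrite /budget; apply: leq_trans (leq_sub2r _ leh); rewrite sum_extra // addKn.
Qed.

(** Both faces have exhausted the budget outside [r0], so their extras, ordered columnwise with
    equal sums, coincide; together with [ysupp] they determine the heights. *)
Lemma eq_height F G : (0 < m)%N -> F \in P -> S \subset G -> G \subset F ->
  (budget <= extras G)%N -> ysupp G = ysupp F -> height G =1 height F.
Proof.
move=> m0 PF SG sGF leb eY.
have leF := extras_budget m0 PF (subset_trans SG sGF).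
have eE r : extra G r = extra F r.
  have [->|ner] := eqVneq r r0.
    by have := extraS r0 sGF; have := extrasS sGF; lia.
  have eEs : extras G = extras F by have := extrasS sGF; lia.
  have := @leqif_sum _ (fun r => r != r0) (fun r => extra G r == extra F r)
    (extra G) (extra F) (fun r _ => leqif_eq (extraS r sGF)).
  rewrite -/(extras G) -/(extras F) eEs => -[_].
  by rewrite eqxx => /esym/forall_inP/(_ r ner)/eqP.
move=> r; have [Yr|nYr] := boolP (r \in ysupp F); last first.
  have := nYr; rewrite notin_ysupp => /eqP->.
  by apply/eqP; rewrite -notin_ysupp eY.
have := eE r; have := heightS r SG; have := heightS r sGF.
have := Yr; rewrite -eY !inE in Yr *; rewrite /extra; lia.
Qed.

Lemma eq_extras F G :
  (forall r, r != r0 -> height F r = height G r) -> extras F = extras G.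
Proof. by move=> eh; apply: eq_bigr => r /eh; rewrite /extra => ->. Qed.

Lemma eq_tight_rank F G : height F =1 height G -> tight_rank F = tight_rank G.
Proof. by move=> eh; rewrite /tight_rank (eq_extras (fun r _ => eh r)) (eq_ysupp eh). Qed.

Lemma tight_matching : (0 < m)%N -> r0 \in ysupp S ->
  link_matching P S tight_rank tight_toggle.
Proof.
move=> m0 Sr0; split=> [F G DF SG sGF|F G DF SG sGF|F u DF SF].
- apply: leq_add; first exact: extrasS.
  apply: leq_mul; last exact/subset_leq_card/ysuppS.
  by case: (leqP budget (extras G)) => //= /leq_trans/(_ (extrasS sGF)) ->.
- have leE := extrasS sGF; have leY := subset_leq_card (ysuppS sGF).
  rewrite /tight_rank /tight_toggle => erk.
  have eE : extras G = extras F.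
    apply/eqP; rewrite eqn_leq leE /= leqNgt; apply/negP=> ltE.
    move: erk; apply/eqP; rewrite neq_ltn; apply/orP; left.
    rewrite -addSn leq_add // leq_mul //; case: (leqP budget (extras G)) => // leb.
    by rewrite (leq_trans leb).
  move: erk; rewrite eE => /addnI; case: leqP => //= leb; rewrite !mul1n => szY.
  have eY : ysupp G = ysupp F by apply/eqP; rewrite eqEcard ysuppS //= szY.
  have eh : height G =1 height F by apply: eq_height => //; rewrite eE.
  rewrite eY (eq_pick (fun r => congr1 (leq _) (eh r))).
  by case: pickP => // r _; rewrite eh.
have [dis leY leh xT] := partition_faceP _ m0 DF.
have DS := faces_closed SF DF; have [_ _ leS _] := partition_faceP _ m0 DS.
have Fr0 : r0 \in ysupp F by apply: (subsetP (ysuppS SF)).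
have hS0 : (0 < height S r0)%N by rewrite inE in Sr0.
have leb := extras_budget m0 DF SF.
rewrite /tight_toggle; case: ltnP => [ltb|geb].
  (* A positive budget means that column [r0] of [S] is not full, so the vertex above it exists. *)
  case=> <-; have le0 : (height S r0 <= b)%N.
    have le1 : (height S r0 - 1 <= \sum_r (height S r - 1))%N by rewrite (bigD1 r0) //= leq_addr.
    by move: ltb; rewrite /budget; lia.
  set v := yvertex _ _; have hF s := height_add_yvertex F r0 s le0.
  have hF' s : s != r0 -> height (v |: F) s = height F s by rewrite hF => /negPf->.
  have hF'' s : s != r0 -> height (F :\ v) s = height F s.
    by move=> ne; rewrite height_dely ?ne.
  have rkE G : (forall s, s != r0 -> height G s = height F s) -> tight_rank G = tight_rank F.
    by move=> eh; rewrite /tight_rank (eq_extras eh) leqNgt ltb.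
  split; [by apply: yvertex_notin|  |exact: rkE|exact: rkE].
  have eY : ysupp (v |: F) = ysupp F.
    apply/setP=> s; have [->|ne] := eqVneq s r0; last by rewrite !inE hF'.
    by rewrite Fr0 inE hF eqxx leq_max.
  apply/partition_faceP=> //; rewrite eY xset_addy; split=> //.
  rewrite sum_extra ?(subset_trans SF) ?subsetUr // (eq_extras hF').
  (* Either [extra] is unchanged at [r0], or it goes from 0 to 1, and [ltb] leaves room for that
     unit. *)
  have : (extra (v |: F) r0 <= maxn 1 (extra F r0))%N.
    by rewrite /extra hF eqxx; lia.
  by move: leb ltb leS; rewrite /budget; lia.
case: pickP => [r lehr|_].
  case=> <-; have lehb := height_bound F r.
  have lek : (height F r - 2 <= b)%N by move: lehb => /=; lia.
  set v := yvertex _ _.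
  have hF : height (v |: F) =1 height F.
    by move=> s; rewrite height_add_yvertex //; case: (eqVneq s r) => [->|//]; lia.
  have hF' : height (F :\ v) =1 height F.
    by move=> s; rewrite height_dely // inordK //; apply/orP; right; lia.
  split; [| |exact: eq_tight_rank|exact: eq_tight_rank].
    by apply: yvertex_notin => //; lia.
  by apply: (eq_height_face m0 hF) DF; rewrite xset_addy.
case E : pick_out => [r|//] [<-].
have := pick_out_some E; rewrite in_setU negb_or => /andP[nS nY].
split; [by rewrite inE in nS| | |].
- apply: add_x_face => //; apply: add_x_neqT => //.
  by apply/set0Pn; exists r0.
- exact/eq_tight_rank/height_addx.
exact/eq_tight_rank/height_delx.
Qed.

(** A critical face spends the whole budget outside [r0] and has an x wherever it has no y, which
    fixes its size. Each column exceeds [S] by at most one, so only columns of [ysupp S] other than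
    [r0] carry an extra, one each. *)
Lemma tight_critical F : (0 < m)%N -> r0 \in ysupp S ->
  initial S -> F \in P -> S \subset F -> tight_toggle F = None ->
  #|F| = (p + b.+1)%N /\ (budget < #|ysupp S|)%N.
Proof.
move=> m0 Sr0 Sini DF SF.
have [dis leY leh xT] := partition_faceP _ m0 DF.
have leb := extras_budget m0 DF SF.
rewrite /tight_toggle; case: ltnP => // geb; case: pickP => // hle.
case: pick_outP => // eT _.
have eX : xset F = ~: ysupp F.
  apply/setP=> r; rewrite in_setC; have [Yr|nYr] /= := boolP (r \in ysupp F).
    by rewrite (disjointFl dis Yr).
  apply: (subsetP (xsetS SF)).
  by have : r \in setT by []; rewrite -eT in_setU (negPf nYr) orbF.
have ex0 : extra F r0 = 0%N by lia.
have exb : extras F = budget by lia.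
have hle' r : (height F r <= (height S r).+1)%N.
  by have := hle r; rewrite leqNgt ltnS => /negbFE.
have Fini : initial F.
  move=> r j ltj; have [lt'|ge'] := ltnP j (height S r).
    by apply: (subsetP SF); apply: Sini.
  have [i Fi ei] := @height_mem _ _ F r (leq_ltn_trans (leq0n _) ltj).
  suff -> : j = i by [].
  by apply/val_inj/eqP; rewrite /= -eqSS ei eqn_leq ltj (leq_trans (hle' r)).
have [_ _ leS _] := partition_faceP _ m0 (faces_closed SF DF).
split.
  rewrite card_initial // sum_height eX sum_extra // exb ex0 addn0 addnCA cardsCs setCK.
  rewrite card_ord subnK; last by rewrite -[X in (_ <= X)%N](card_ord p.+1) max_card.
  by rewrite /budget subnKC // !addnS addnC.
rewrite -exb (cardsD1 r0) Sr0 ltnS -sum1_card.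
rewrite /extras big_mkcond [X in (_ <= X)%N]big_mkcond /=.
apply: leq_sum => r _; rewrite !inE; case: eqP => // _ /=.
by have := hle' r; rewrite /extra; case: (height S r) => [|n] /=; lia.
Qed.

End Tight.
End Matchings.

(** * Degrees of nonzero homology and the sizes of the faces *)

Section Homology.
Variables (K : fieldType) (b p m : nat).
Local Notation P := (partition_complex b.+2 p m).
Implicit Types (F G S : {set pvertex b.+2 p}) (r : 'I_p.+1).

(** With many free positions [i] is [#|~: xset S| - 1], at least [m]. In the tight case it is
    [#|~: xset S| + budget - #|ysupp S|], below [m] because the budget is less than [#|ysupp S|]. *)
Lemma nonzero_link_size S (i : nat) : (0 < m)%N -> S \in P ->
  homology K (link P S) (i%:Z - 1) != 0%VS ->
  (i < m)%N /\ (#|S| + i = p + b.+1)%N \/ (m <= i)%N /\ (#|S| + i = p)%N.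
Proof.
move=> m0 DS nz.
have Sini : initial S.
  move=> r j ltj; apply: contraT => nS.
  have ltj' : (j.+1 < height S r)%N.
    rewrite ltn_neqAle ltj andbT; apply: contra nS => /eqP ej.
    have [k Sk] := @height_mem _ _ S r (leq_ltn_trans (leq0n _) ltj).
    by rewrite -ej => -[/val_inj <-].
  by have [F []] := link_nonzero_critical (cone_matching m0 nS ltj') nz.
have := card_initial Sini; have := cardsC (xset S); rewrite card_ord => szX szS.
have [ltm|lem] := ltnP m #|~: xset S|.
  have [F [DF SF wF szF]] := link_nonzero_critical (many_matching S m0) nz.
  have [YF0 szF'] := many_critical m0 ltm DF wF.
  have /eqP YS0 : ysupp S == set0 by rewrite -subset0 -YF0 ysuppS.
  move: szS; rewrite big1 ?addn0 => [szS|r _]; first by right; lia.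
  by apply/eqP; rewrite -notin_ysupp YS0 inE.
have [YS0|/set0Pn[r0 Sr0]] := eqVneq (ysupp S) set0.
  have [F [DF SF wF szF]] := link_nonzero_critical (few_matching m0 lem YS0) nz.
  by have := few_toggle_neq0 m0 DF.
have [F [DF SF wF szF]] := link_nonzero_critical (tight_matching m0 Sr0) nz.
have [szF' ltb] := tight_critical m0 Sr0 Sini DF SF wF.
have [_ _ leS _] := partition_faceP _ m0 DS.
move: szS ltb; rewrite sum_height /budget => szS ltb.
by left; lia.
Qed.

Lemma exists_link_low (i : nat) : (i < m)%N -> (m <= p)%N ->
  exists2 S, S \in P & homology K (link P S) (i%:Z - 1) != 0%VS.
Proof.
move=> ltim lemp; have m0 : (0 < m)%N by apply: leq_ltn_trans ltim.
pose X : {set 'I_p.+1} := [set r : 'I_p.+1 | (m <= r)%N].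
(* The full column 0 spends the whole bound [b], so the budget is 0; [F] and [S] then differ by [i]
   columns of height 1. *)
pose c n r := if r == ord0 then b.+1 else nat_of_bool (r < n)%N.
pose S := layers b.+2 X (c (m - i)%N) : {set pvertex b.+2 p}.
pose F := layers b.+2 X (c m) : {set pvertex b.+2 p}.
have hE n r : height (layers b.+2 X (c n) ) r = c n r.
  rewrite height_layers; apply/minn_idPr; rewrite /c; case: eqP => // _.
  by case: (r < n)%N.
have sum1 n : (\sum_r (height (layers b.+2 X (c n) ) r - 1) = b)%N.
  rewrite big_ord_recl hE subn1 big1 ?addn0 // => r _.
  by rewrite hE /c /=; case: (_ < n)%N.
have eY : ysupp F = ~: X.
  apply/setP=> r; rewrite !inE hE /c; case: eqP => [->|_]; first by rewrite leqn0 -lt0n m0.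
  by rewrite -ltnNge; case: (r < m)%N.
have szY : #|~: X| = m.
  rewrite -[RHS](minn_idPr (leqW lemp)) -card_ltn; apply: eq_card => r.
  by rewrite !inE -ltnNge.
have SF : S \subset F.
  apply/subsetP=> -[r|[r j]]; rewrite !inE // => /leq_trans; apply.
  by rewrite /c; case: eqP => // _; case: ltnP => // /leq_trans -> //; apply: leq_subr.
have DF : F \in P.
  apply/partition_faceP=> //; rewrite eY szY sum1 xset_layers; split=> //.
    by rewrite disjoints_subset setCK.
  by apply/eqP=> /setP/(_ ord0); rewrite !inE leqn0 (gtn_eqF m0).
have S0 : ord0 \in ysupp S by rewrite inE hE.
have Sini : initial S by apply: layers_initial.
have wF : tight_toggle S ord0 F = None.
  rewrite /tight_toggle /budget sum1 subnn ltn0; case: pickP => [r|_].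
    by rewrite !hE /c; case: eqP => _; [rewrite ltnNge leqnSn|case: (r < m)%N].
  by rewrite eY xset_layers setUCr; case: pick_outP => // r; rewrite inE.
have [szF _] := tight_critical m0 S0 Sini DF SF wF.
exists S; first exact: faces_closed DF.
have -> : i = (#|F| - #|S|)%N.
  rewrite szF card_initial // xset_layers big_ord_recl hE -[c _ _]/b.+1.
  rewrite (eq_bigr (fun r : 'I_p => nat_of_bool (r < (m - i).-1)%N)) => [|r _].
    rewrite sum_ltn; have := cardsC X; rewrite szY card_ord; lia.
  by rewrite hE /c /=; congr nat_of_bool; rewrite /bump /=; lia.
apply: (link_critical_nonzero K (tight_matching m0 S0)) => // G DG SG wG.
by rewrite szF; have [] := tight_critical m0 S0 Sini DG SG wG.
Qed.

Lemma exists_link_high (i : nat) : (0 < m)%N -> (m <= i)%N -> (i <= p)%N ->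
  exists2 S, S \in P & homology K (link P S) (i%:Z - 1) != 0%VS.
Proof.
move=> m0 lemi leip.
(* This leaves [i.+1 > m] positions free. *)
pose X : {set 'I_p.+1} := [set r : 'I_p.+1 | (i < r)%N].
pose S := layers b.+2 X (fun=> 0%N) : {set pvertex b.+2 p}.
(* The x missing from the critical face has to be the one that [many_toggle] picks. *)
have [r0 nr0 er0] : exists2 r0, r0 \notin X & pick_out X = Some r0.
  case: pick_outP => [r nr|/setP/(_ ord0)]; first by exists r.
  by rewrite !inE.
pose F := layers b.+2 (~: [set r0]) (fun=> 0%N) : {set pvertex b.+2 p}.
have hE Y r : height (layers b.+2 Y (fun=> 0%N) ) r = 0%N.
  by rewrite height_layers minn0.
have YE Y : ysupp (layers b.+2 Y (fun=> 0%N) : {set pvertex b.+2 p}) = set0.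
  by apply/setP=> r; rewrite !inE hE.
have szX : #|~: X| = i.+1.
  rewrite -[RHS](minn_idPr (_ : i.+1 <= p.+1)%N) // -card_ltn; apply: eq_card => r.
  by rewrite !inE -leqNgt.
have SF : S \subset F.
  apply/subsetP=> -[r|[r j]]; rewrite !inE //.
  by apply: contraTneq => ->; rewrite inE in nr0.
have DF : F \in P.
  apply/partition_faceP=> //; rewrite YE cards0 xset_layers; split=> //.
  - by rewrite disjoint_sym disjoints_subset sub0set.
  - by rewrite big1 // => r _; rewrite hE.
  by apply/eqP=> /setP/(_ r0); rewrite !inE eqxx.
have ltm : (m < #|~: xset S|)%N by rewrite xset_layers szX.
have wF : many_toggle S F = None.
  by rewrite /many_toggle YE !xset_layers setU0 er0 !eqxx setUCr eqxx.
have [_ szF] := many_critical m0 ltm DF wF.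
exists S; first exact: faces_closed DF.
have -> : i = (#|F| - #|S|)%N.
  rewrite szF card_layers big1 => [|r _]; last by rewrite minn0.
  by have := cardsC X; rewrite szX card_ord; lia.
apply: (link_critical_nonzero K (many_matching S m0)) => // G DG SG wG.
by rewrite szF; have [] := many_critical m0 ltm DG wG.
Qed.

End Homology.

Lemma map_const_in (T : eqType) (U : eqType) (f : T -> U) (s : seq T) (y : U) :
  {in s, forall x, f x = y} -> map f s = nseq (size s) y.
Proof.
move=> fy; rewrite -(size_map f s); apply/all_pred1P; rewrite all_map.
by apply/allP=> x /fy /= ->.
Qed.

Theorem theorem5p57 (K : fieldType) (a p m : nat)
    (ha : (2 <= a)%N) (hm : (1 <= m)%N) (hmp : (m <= p)%N) :
  PR K (partition_complex a p m) /\
  degree_type K (partition_complex a p m)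
    (nseq (p - m) 1 ++ a%:Z :: nseq (m - 1) 1).
Proof.
case: a ha => [|[|b]] // _; split.
  move=> i S T lei DS DT; have [j ->] : exists j : nat, i = j%:Z - 1.
    by exists (absz (i + 1)); lia.
  move=> /(nonzero_link_size hm DS) + /(nonzero_link_size hm DT); lia.
(* For [i <= p] this drops by 1 at each step, except from [m - 1] to [m], where it drops by
   [b.+2 = a]. *)
pose s i := if (i < m)%N then (p + b.+1 - i)%N else (p - i)%N.
exists p, s; split.
- exact: exists_link_high.
- by move=> i S DS /(nonzero_link_size hm DS); lia.
- move=> i leip; split.
    by have [lt|ge] := ltnP i m; [apply: exists_link_low|apply: exists_link_high].
  by move=> S DS /(nonzero_link_size hm DS); rewrite /s; case: ltnP; lia.
(* The list is split at the exceptional index [m]; after reversal the [p - m] larger indices come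
   first. *)
have -> : iota 1 p = iota 1 (m - 1) ++ m :: iota m.+1 (p - m).
  have -> : iota 1 p = iota 1 (m - 1 + (1 + (p - m))) by congr iota; lia.
  by rewrite !iotaD /= subnKC // addn1.
rewrite rev_cat rev_cons cat_rcons map_cat /=.
congr (_ ++ _).
  rewrite (map_const_in (y := 1)) => [|i]; last first.
    rewrite mem_rev mem_iota => lei; rewrite /s; do 2 case: ltnP; lia.
  by rewrite size_rev size_iota; congr nseq; lia.
congr (_ :: _).
  by rewrite /s ltn_predL hm ltnn; lia.
rewrite (map_const_in (y := 1)) => [|i]; last first.
  rewrite mem_rev mem_iota => lei; have [l1 l2] : (i < m)%N /\ (i.-1 < m)%N by lia.
  by rewrite /s l1 l2; lia.
by rewrite size_rev size_iota.
Qed.
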